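(* Let $M\subset\mathbb{C}^{10}$ be the quadratic submanifold of real codimension $4$ given in the coordinates $(z_1,z_2,z_3,z_1',z_2',z_3',w_1,w_2,w_3,w_1')$ by $$\operatorname{Im} w_1=-iz_1\bar z_2+iz_2\bar z_1,\qquad \operatorname{Im} w_2=-iz_2\bar z_3+iz_3\bar z_2,\qquad \operatorname{Im} w_3=-iz_1\bar z_3+iz_3\bar z_1,$$ $$\operatorname{Im} w_1'=z_1\bar z_1'+z_1'\bar z_1+z_2\bar z_2'+z_2'\bar z_2+z_3\bar z_3'+z_3'\bar z_3 .$$ Then $M$ admits a nonzero infinitesimal CR automorphism at $0$ which is weighted homogeneous of weighted order $4$ and whose coefficients are homogeneous polynomials of degree $3$.
   Context: An infinitesimal CR automorphism of $M$ at $0$ is a germ at $0$ of a holomorphic vector field on $\mathbb{C}^{10}$ whose real part is tangent to $M$ along $M$. Weights: every variable $z_j,z_j'$ has weight $1$, every variable $w_j,w_j'$ has weight $2$, $\partial/\partial z_j,\partial/\partial z_j'$ have weight $-1$ and $\partial/\partial w_j,\partial/\partial w_j'$ have weight $-2$; a vector field is weighted homogeneous of weighted order $b$ if all its terms have total weight $b$. ''Homogeneous polynomial of degree $3$'' refers to the ordinary degree in all variables (a zero coefficient being allowed). *)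

(* Defs.v *)
From HB Require Import structures.
From mathcomp Require Import all_boot all_order all_algebra.
From mathcomp Require Import complex.
From mathcomp Require Import all_classical all_reals all_analysis.
(* The notations of mpoly clash with those of MathComp-Analysis: {mpoly A[n]}
   is written [mpoly n A], p.@[v] is [meval v p], and p \is d.-homog is
   [p \is ishomog1 d mdeg]. *)
From mathcomp Require Import -(notations) mpoly.

Set Implicit Arguments.
Unset Strict Implicit.
Unset Printing Implicit Defensive.

Import Order.TTheory GRing.Theory Num.Theory.
Import numFieldNormedType.Exports.

Local Open Scope classical_set_scope.
Local Open Scope ring_scope.
Local Open Scope complex_scope.

(* R[i] as a normed space over itself, so that [differentiable] on
   'rV[R[i]]_n means complex differentiable. *)
HB.instance Definition _ (R : realType) := NormedModule.copy R[i] R[i]^o.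

Section CRAutomorphism.
Variables (R : realType) (n : nat).
Implicit Types (M : set 'rV[R[i]]_n) (p v : 'rV[R[i]]_n).

(* Tangent vectors of M at p as velocities of curves in M; C^n is regarded as
   R^(2n) through the real and imaginary parts of the coordinates. *)
Definition tangent M p v : Prop :=
  exists gamma : R -> 'rV[R[i]]_n,
    [/\ gamma 0 = p,
        \forall t \near 0, M (gamma t),
        forall j, is_derive (0 : R) (1 : R)
          (fun t => complex.Re (gamma t 0 j)) (complex.Re (v 0 j)) &
        forall j, is_derive (0 : R) (1 : R)
          (fun t => complex.Im (gamma t 0 j)) (complex.Im (v 0 j))].

(* A function X represents the germ at 0 of sum_j X_j d/dx_j.  Since
   d/dx_j = (d/d(Re x_j) - i d/d(Im x_j)) / 2, the real part of this field is
   the real vector field whose value at p is X p / 2 under C^n = R^(2n). *)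
Definition infinitesimal_CR_automorphism M (X : 'rV[R[i]]_n -> 'rV[R[i]]_n) :
    Prop :=
  (\forall p \near (0 : 'rV[R[i]]_n), differentiable X p) /\
  (\forall p \near (0 : 'rV[R[i]]_n), M p -> tangent M p (2^-1 *: X p)).

Definition poly_vfield (P : 'I_n -> mpoly n R[i]) (p : 'rV[R[i]]_n) :
    'rV[R[i]]_n :=
  \row_j meval (p 0) (P j).

(* The variable x_j has weight wt j, and d/dx_j has weight - wt j. *)
Definition weighted_homogeneous (wt : 'I_n -> nat) (b : int)
    (P : 'I_n -> mpoly n R[i]) : Prop :=
  forall j m, m \in msupp (P j) ->
    (\sum_(i < n) wt i * m i)%N%:Z - (wt j)%:Z = b.

End CRAutomorphism.

Section Quadric.
Variable R : realType.

(* The coordinates of C^10 are, in this order,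
   z1, z2, z3, z1', z2', z3', w1, w2, w3, w1'. *)
Definition quadric : set 'rV[R[i]]_10 := [set p : 'rV[R[i]]_10 |
  let x k : R[i] := p 0 (inord k) in
  let z1 := x 0%N in let z2 := x 1%N in let z3 := x 2%N in
  let z1' := x 3%N in let z2' := x 4%N in let z3' := x 5%N in
  let w1 := x 6%N in let w2 := x 7%N in let w3 := x 8%N in
  let w1' := x 9%N in
  [/\ (complex.Im w1)%:C = - 'i * z1 * z2^* + 'i * z2 * z1^*,
      (complex.Im w2)%:C = - 'i * z2 * z3^* + 'i * z3 * z2^*,
      (complex.Im w3)%:C = - 'i * z1 * z3^* + 'i * z3 * z1^* &
      (complex.Im w1')%:C = z1 * z1'^* + z1' * z1^* + z2 * z2'^* + z2' * z2^*
                            + z3 * z3'^* + z3' * z3^*]].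

Definition quadric_weight (j : 'I_10) : nat := if (j < 6)%N then 1 else 2.

End Quadric.

(* Main.v *)
(** Put W = (w2, - w3, w1) and z = (z1, z2, z3).  The first three equations of
    the quadric say that Im W is, up to a real factor, the cross product of
    Re z and Im z, so Im W is orthogonal to both, and W . z = (Re W) . z on the
    quadric.  The field i (W . z) (W . d/dz') therefore satisfies
    Re (i (W . z) (W . z^* )) = Re (i |(Re W) . z|^2) = 0 there.  As it only
    moves z', and the quadric is real affine in z', the quadric contains the
    real line through each of its points in the direction of the field. *)

Require Import Defs.
From HB Require Import structures.
From mathcomp Require Import all_boot all_order all_algebra.
From mathcomp Require Import ring.
From mathcomp Require Import complex.
From mathcomp Require Import all_classical all_reals all_analysis.
From mathcomp Require Import -(notations) mpoly.
Import Order.TTheory GRing.Theory Num.Theory.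
Local Open Scope ring_scope.
Local Open Scope complex_scope.

(** * Weighted degree of monomials *)

Section WeightedDegree.
Variables (n : nat) (wt : 'I_n -> nat).

(** Made a [measure] below, so that the closure lemmas of [ishomog1] serve weights as well as
    [mdeg]. *)
Definition mweight (m : multinom n) : nat := \sum_(i < n) wt i * m i.

Lemma mweight0 : mweight mnm0 = 0%N.
Proof. by apply: big1 => i _; rewrite mnm0E muln0. Qed.

Lemma mweightD (m1 m2 : multinom n) :
  mweight (mnm_add m1 m2) = (mweight m1 + mweight m2)%N.
Proof.
by rewrite /mweight -big_split; apply: eq_bigr => i _; rewrite mnmDE mulnDr.
Qed.

HB.instance Definition _ := isMeasure.Build n mweight mweight0 mweightD.

Lemma mweightU i : mweight (mnm1 i) = wt i.
Proof.
rewrite /mweight (bigD1 i) //= mnm1E eqxx muln1 big1 ?addn0 // => j ji.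
by rewrite mnm1E eq_sym (negPf ji) muln0.
Qed.

End WeightedDegree.

Lemma weighted_homogeneousP (R : realType) (n : nat) (wt : 'I_n -> nat)
    (b : nat) (P : 'I_n -> mpoly n R[i]) :
  (forall j, P j \is ishomog1 (b + wt j) (mweight n wt)) ->
  weighted_homogeneous wt b P.
Proof.
move=> PH j m mP; move/dhomogP: (PH j) => /(_ m mP) /= E.
by rewrite -[X in X%:Z]/(mweight n wt m) E PoszD addrK.
Qed.

(** * Holomorphy of polynomial fields, and tangency along real lines *)

Lemma differentiable_meval (R : realType) (n : nat) (Q : mpoly n R[i])
    (p : 'rV[R[i]]_n) :
  differentiable (fun q : 'rV[R[i]]_n => meval (q 0) Q : R[i]) p.
Proof.
have -> : (fun q : 'rV[R[i]]_n => meval (q 0) Q : R[i]) =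
    \sum_(m <- msupp Q) (mcoeff m Q *:
       \prod_(i < n) (fun q : 'rV[R[i]]_n => q 0 i : R[i]) ^+ m i).
  apply/funext => q; rewrite mevalE fct_sumE; apply: eq_bigr => m _.
  rewrite /= fctE; congr (_ * _); rewrite fct_prodE.
  by apply: eq_bigr => i _; rewrite exprfctE.
elim/big_ind: _ => [|f g df dg|m _]; first exact: differentiable_cst.
  exact: differentiableD.
apply: differentiableZ; elim/big_ind: _ => [|f g df dg|i _].
- exact: differentiable_cst.
- exact: differentiableM.
case: (m i) => [|k]; first by rewrite expr0; exact: differentiable_cst.
by apply: differentiableX; exact: differentiable_coord.
Qed.

Lemma differentiable_poly_vfield (R : realType) (n : nat)
    (P : 'I_n -> mpoly n R[i]) (p : 'rV[R[i]]_n) :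
  differentiable (poly_vfield P) p.
Proof.
have -> : poly_vfield P = \sum_(j < n)
    (fun q : 'rV[R[i]]_n => meval (q 0) (P j) *: (delta_mx 0 j : 'rV[R[i]]_n)).
  apply/funext => q; rewrite fct_sumE [LHS]row_sum_delta.
  by apply: eq_bigr => j _; rewrite mxE.
apply: differentiable_sum => j; apply: differentiableZl.
exact: differentiable_meval.
Qed.

(** The line itself serves as the curve: since t is real, the real and imaginary parts of its
    coordinates are affine in t, with slopes read off from [v]. *)
Lemma tangent_line (R : realType) (n : nat) (M : set 'rV[R[i]]_n)
    (p v : 'rV[R[i]]_n) :
  (forall t : R, M (p + t%:C *: v)) -> tangent M p v.
Proof.
move=> Mpv; exists (fun t : R => p + t%:C *: v).
have aff (a b : R) : is_derive (0 : R) (1 : R) (fun t => a + t * b) b.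
  have -> : (fun t => a + t * b) = cst a + b *: id.
    by apply/funext => t /=; rewrite fctE /= mulrC.
  by apply: is_derive_eq; rewrite add0r [_ *: _]mulr1.
split=> [||j|j]; first by rewrite scale0r addr0.
- by near=> t; exact: Mpv.
- rewrite (_ : (fun _ => _) =
    (fun t => complex.Re (p 0 j) + t * complex.Re (v 0 j))) //.
  apply/funext => t; rewrite !mxE; case: (p 0 j) (v 0 j) => [a b] [c d] /=.
  by rewrite mul0r subr0.
- rewrite (_ : (fun _ => _) =
    (fun t => complex.Im (p 0 j) + t * complex.Im (v 0 j))) //.
  apply/funext => t; rewrite !mxE; case: (p 0 j) (v 0 j) => [a b] [c d] /=.
  by rewrite mul0r addr0.
Unshelve. all: by end_near. Qed.

(** * The algebraic identity, over an arbitrary [numClosedFieldType] *)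

Section Orthogonality.
Local Close Scope complex_scope.

Lemma subCJ (C : numClosedFieldType) (w : C) : w - w^* = 2 * 'i * 'Im w.
Proof. by rewrite {1 2}[w]Crect conjC_rect ?Creal_Re ?Creal_Im //; ring. Qed.

(** Here s = W . z and f = i s W. The sum is i times the difference of s (W . z^* ) and its
    conjugate; [st] says that W . z^* is the conjugate of s, so both terms equal s s^* and
    cancel. *)
Lemma Wfield_orthogonal (C : numClosedFieldType) (z1 z2 z3 w1 w2 w3 : C) :
  'Im w1 = - 'i * z1 * z2^* + 'i * z2 * z1^* ->
  'Im w2 = - 'i * z2 * z3^* + 'i * z3 * z2^* ->
  'Im w3 = - 'i * z1 * z3^* + 'i * z3 * z1^* ->
  let s := w2 * z1 + - w3 * z2 + w1 * z3 in
  let f1 := 'i * (w2 * s) in let f2 := 'i * (- w3 * s) in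
  let f3 := 'i * (w1 * s) in
  z1 * f1^* + f1 * z1^* + z2 * f2^* + f2 * z2^* + z3 * f3^* + f3 * z3^* = 0.
Proof.
move=> e1 e2 e3 s f1 f2 f3.
have d1 := subCJ _ w1; have d2 := subCJ _ w2; have d3 := subCJ _ w3.
rewrite e1 in d1; rewrite e2 in d2; rewrite e3 in d3.
have st : s^* = w2 * z1^* + - w3 * z2^* + w1 * z3^*.
  rewrite !(rmorphD, rmorphM, rmorphN) /=; apply/eqP; rewrite -subr_eq0.
  (* This is - (W - W^* ) . z^*. As W - W^* is a multiple of the cross product of z and z^*, it
     becomes a determinant with a repeated row. The square of ['i] is only a common factor, so
     [ring] does not need its value. *)
  apply/eqP; transitivity (- (w2 - w2^*) * z1^* + (w3 - w3^*) * z2^*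
    - (w1 - w1^*) * z3^*); first by ring.
  by rewrite d1 d2 d3; ring.
have st' : s = w2^* * z1 + - w3^* * z2 + w1^* * z3.
  by rewrite -[s]conjCK st !(rmorphD, rmorphM, rmorphN) /= !conjCK.
have -> : f1^* = - 'i * (w2^* * s^*) by rewrite !rmorphM /= conjCi.
have -> : f2^* = - 'i * (- w3^* * s^*) by rewrite !rmorphM rmorphN /= conjCi.
have -> : f3^* = - 'i * (w1^* * s^*) by rewrite !rmorphM /= conjCi.
transitivity ('i * (s * (w2 * z1^* + - w3 * z2^* + w1 * z3^*)
  - s^* * (w2^* * z1 + - w3^* * z2 + w1^* * z3))).
  by rewrite /f1 /f2 /f3; ring.
by rewrite -st -st'; ring.
Qed.

End Orthogonality.

(** * The field and its properties *)

Section Field.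
Variable R : realType.

Let X (k : nat) : mpoly 10 R[i] := mpolyX R[i] (mnm1 (inord k : 'I_10)).

Definition Wcoord (k : nat) : mpoly 10 R[i] :=
  [:: X 7; - X 8; X 6]`_k.

Definition Wdotz : mpoly 10 R[i] :=
  Wcoord 0 * X 0 + Wcoord 1 * X 1 + Wcoord 2 * X 2.

Definition Wfield (j : 'I_10) : mpoly 10 R[i] :=
  if (3 <= j < 6)%N then 'i%R *: (Wcoord (j - 3) * Wdotz) else 0.

Lemma dhomogXord (mf : measure 10) k :
  X k \is ishomog1 (mf (mnm1 (inord k : 'I_10))) mf.
Proof. by rewrite dhomogX. Qed.

(** Each z' coefficient is quadratic in W and linear in z. Keeping [mf] general settles both
    gradings: a = b = 1 gives degree 3, while a = 1, b = 2 gives weight 5, that is order 4 once the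
    weight -1 of d/dz' is added. *)
Lemma Wfield_dhomog (mf : measure 10) (a b : nat) :
  (forall k, (k < 3)%N -> mf (mnm1 (inord k : 'I_10)) = a) ->
  (forall k, (6 <= k < 9)%N -> mf (mnm1 (inord k : 'I_10)) = b) ->
  forall j : 'I_10, (3 <= j < 6)%N -> Wfield j \is ishomog1 (b + (b + a)) mf.
Proof.
move=> mfz mfw j jz'.
have homW k : (k < 3)%N -> Wcoord k \is ishomog1 b mf.
  case: k => [|[|[|//]]] _; rewrite /Wcoord /= ?dhomogN.
  - by rewrite -(mfw 7); first exact: dhomogXord.
  - by rewrite -(mfw 8); first exact: dhomogXord.
  - by rewrite -(mfw 6); first exact: dhomogXord.
have homX k : (k < 3)%N -> X k \is ishomog1 a mf.
  by move=> k3; rewrite -(mfz k k3); exact: dhomogXord.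
rewrite /Wfield jz'; apply: dhomogZ; apply: dhomogM.
  by apply: homW; case/andP: jz' => j3 j6; rewrite ltn_subLR.
by rewrite !dhomogD //; apply: dhomogM; auto.
Qed.

Lemma Wfield_dhomog3 j : Wfield j \is ishomog1 3 (@mdeg 10).
Proof.
have [jz'|jz'] := boolP (3 <= j < 6)%N; last first.
  by rewrite /Wfield (negPf jz'); exact: dhomog0.
by apply: (@Wfield_dhomog _ 1 1) => // k _; exact: mdeg1.
Qed.

Lemma Wfield_weighted : weighted_homogeneous quadric_weight 4 Wfield.
Proof.
apply: weighted_homogeneousP => j.
have [jz'|jz'] := boolP (3 <= j < 6)%N; last first.
  by rewrite /Wfield (negPf jz'); exact: dhomog0.
have -> : quadric_weight j = 1%N.
  by case/andP: jz' => _; rewrite /quadric_weight => ->.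
apply: (@Wfield_dhomog _ 1 2) => // k kb; rewrite /= mweightU /quadric_weight.
  by rewrite inordK; [rewrite (ltn_trans kb) | exact: ltn_trans kb _].
case/andP: kb => k6 k9.
by rewrite inordK; [rewrite ltnNge k6 | exact: ltn_trans k9 _].
Qed.

Lemma Wfield_neq0 : Wfield (inord 3) != 0.
Proof.
(* At z1 = w2 = 1, with all other variables 0, the d/dz1' coefficient takes the value i. *)
apply/eqP => /(congr1 (meval (fun k : 'I_10 =>
  if (k == inord 0 :> 'I_10) || (k == inord 7 :> 'I_10) then 1 else 0 : R[i]))).
rewrite /Wfield /Wdotz /Wcoord inordK //= meval0 mevalZ mevalM.
rewrite !mevalD !mevalM !mevalN !mevalXU.
rewrite -!val_eqE /= !inordK //= !(mulr0, mulr1, oppr0, addr0) => /eqP.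
by rewrite eq_complex /= oner_eq0 andbF.
Qed.

(** Along the line z and w stay fixed, so only the right side of the last equation can change; it
    changes by t times the sum that [Wfield_orthogonal] shows to be 0. *)
Lemma quadric_line (p : 'rV[R[i]]_10) (t : R) :
  quadric p -> quadric (p + t%:C *: poly_vfield Wfield p).
Proof.
rewrite /quadric /= => -[e1 e2 e3 e4].
have X0 k : (k < 10)%N -> ~~ (3 <= k < 6)%N ->
    poly_vfield Wfield p 0 (inord k) = 0.
  by move=> k10 kz'; rewrite mxE /Wfield inordK // (negPf kz') meval0.
have XW k : (3 <= k < 6)%N -> poly_vfield Wfield p 0 (inord k) =
    'i%R * (meval (p 0) (Wcoord (k - 3)) *
      (p 0 (inord 7) * p 0 (inord 0) + - p 0 (inord 8) * p 0 (inord 1)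
       + p 0 (inord 6) * p 0 (inord 2))).
  move=> kz'; have k10 : (k < 10)%N by case/andP: kz' => _ /ltn_trans ->.
  rewrite mxE /Wfield inordK // kz' mevalZ mevalM; congr (_ * (_ * _)).
  by rewrite /Wdotz /Wcoord /= !mevalD !mevalM !mevalN !mevalXU.
have lineE k : (p + t%:C *: poly_vfield Wfield p) 0 (inord k) =
    p 0 (inord k) + t%:C * poly_vfield Wfield p 0 (inord k) by rewrite !mxE.
have W1 : meval (p 0) (Wcoord 0) = p 0 (inord 7) by rewrite mevalXU.
have W2 : meval (p 0) (Wcoord 1) = - p 0 (inord 8) by rewrite mevalN mevalXU.
have W3 : meval (p 0) (Wcoord 2) = p 0 (inord 6) by rewrite mevalXU.
rewrite !lineE (X0 0) // (X0 1) // (X0 2) // (X0 6) // (X0 7) // (X0 8) //.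
rewrite (X0 9) // !mulr0 !addr0; split=> //.
(* Passes to the generic ['Im] of [Wfield_orthogonal]. *)
rewrite !complexIm in e1 e2 e3.
have := Wfield_orthogonal _ _ _ _ _ _ _ e1 e2 e3.
rewrite !XW //= W1 W2 W3.
move: ('i%R * (p 0 (inord 7) * _)) ('i%R * (- p 0 (inord 8) * _))
  ('i%R * (p 0 (inord 6) * _)) => f1 f2 f3 ort.
(* Reality of t lets it factor out of the conjugated terms too. *)
have tJ : (t%:C)^*%R = t%:C by exact: conjc_real.
rewrite !(rmorphD, rmorphM) /= tJ e4 -[LHS]addr0 -[X in _ + X](mulr0 t%:C) -ort.
by ring.
Qed.

Lemma Wfield_CR :
  infinitesimal_CR_automorphism (@quadric R) (poly_vfield Wfield).
Proof.
split; near=> p; first exact: differentiable_poly_vfield.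
move=> Mp; apply: tangent_line => t; rewrite scalerA.
(* The factor 1/2 from the real part is absorbed into the real parameter of the line. *)
have -> : t%:C * 2^-1 = (t / 2)%:C by rewrite rmorphM fmorphV rmorph_nat.
exact: quadric_line.
Unshelve. all: by end_near. Qed.

End Field.

Theorem mainTheorem3 (R : realType) :
  exists P : 'I_10 -> mpoly 10 R[i],
    [/\ exists j, P j != 0,
        infinitesimal_CR_automorphism (@quadric R) (poly_vfield P),
        weighted_homogeneous quadric_weight 4 P &
        forall j, P j \is ishomog1 3 (@mdeg 10)].
Proof.
exists (Wfield R); split.
- by exists (inord 3); exact: Wfield_neq0.
- exact: Wfield_CR.
- exact: Wfield_weighted.
- exact: Wfield_dhomog3.
Qed.
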